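(* The relation $\simeq_\varepsilon$ ($\varepsilon$-perturbed bisimilarity) is strictly finer than the relation $\sim_\varepsilon^*$ (transitive $\varepsilon$-bisimilarity).
   Context: Throughout, $\varepsilon\in[0,1]$ denotes a tolerance and all LMCs are finite. Fix a countable set $AP$ of atomic propositions. A finite labeled Markov chain (LMC) $\mathcal{M}=(S,P,s_{init},l)$ has a finite nonempty state set $S$, a transition function $P\colon S\to Distr(S)$ ($Distr(S)$ is the set of probability distributions on $S$), an initial state $s_{init}\in S$ and a labeling $l\colon S\to 2^{AP}$. For $A\subseteq S$, $P(s)(A)=\sum_{t\in A}P(s)(t)$. An equivalence $R\subseteq S\times S$ is a (probabilistic) bisimulation on $\mathcal{M}$ if for all $(s,t)\in R$ and all $R$-equivalence classes $C$: $l(s)=l(t)$ and $P(s)(C)=P(t)(C)$. An $\varepsilon$-perturbation of $\mathcal{M}=(S,P,s_{init},l)$ is an LMC $\mathcal{M}'=(S,P',s_{init},l)$ with $\|P(s)-P'(s)\|_1=\sum_{t\in S}|P(s)(t)-P'(s)(t)|\le\varepsilon$ for all $s\in S$. An equivalence $R$ on $S$ is an $\varepsilon$-perturbed bisimulation on $\mathcal{M}$ if there is an $\varepsilon$-perturbation $\mathcal{M}'$ of $\mathcal{M}$ such that $R$ is a bisimulation on $\mathcal{M}'$. $s\simeq_\varepsilon t$ if $(s,t)\in R$ for some $\varepsilon$-perturbed bisimulation $R$. For $R\subseteq S\times S$ and $A\subseteq S$ let $R(A)=\{t\mid\exists s\in A\colon(s,t)\in R\}$. A reflexive and symmetric $R$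 is an $\varepsilon$-bisimulation if for all $(s,t)\in R$ and all $A\subseteq S$: $l(s)=l(t)$ and $P(s)(A)\le P(t)(R(A))+\varepsilon$. $s\sim_\varepsilon^* t$ if $(s,t)\in R$ for some transitive $\varepsilon$-bisimulation $R$. ''Strictly finer'' means: any two states related by $\simeq_\varepsilon$ are related by $\sim_\varepsilon^*$, while there are an LMC and states $s,t$ of it with $s\sim_\varepsilon^* t$ but $s\not\simeq_\varepsilon t$.
   Formalization: Strictness is claimed for every ε with 0 < ε < 1 and nonempty AP only, since the two relations coincide at ε = 0 (bisimilarity), at ε = 1 (equality of labels) and when AP is empty; the inclusion is claimed for all ε in [0,1]. *)

(* Defs.v *)
From mathcomp Require Import all_boot all_order all_algebra.
From mathcomp Require Import boolp classical_sets reals.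

Set Implicit Arguments.
Unset Strict Implicit.
Unset Printing Implicit Defensive.

Import Order.TTheory GRing.Theory Num.Theory.

Local Open Scope ring_scope.

Record distr (R : realType) (S : finType) := Distr {
  dfun :> S -> R;
  distr_ge0 : forall s, 0 <= dfun s;
  distr_sum1 : \sum_s dfun s = 1
}.

Definition prob (R : realType) (S : finType) (mu : distr R S) (A : {set S}) : R :=
  \sum_(t in A) mu t.

(* The state space is a parameter, so that a perturbation of a chain lives on
   the same states by typing; it is nonempty because of the initial state. *)
Record lmc (R : realType) (AP : countType) (S : finType) := LMC {
  trans : S -> distr R S;
  init : S;
  label : S -> set AP
}.

Section Relations.
Variables (R : realType) (AP : countType) (S : finType).
Implicit Types (M : lmc R AP S) (E : rel S) (eps : R).

Definition bisimulation M E : Prop :=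
  equivalence_rel E /\
  forall s t, E s t ->
    label M s = label M t /\
    forall C : {set S}, C \in equivalence_partition E [set: S] ->
      prob (trans M s) C = prob (trans M t) C.

Definition perturbation eps M M' : Prop :=
  [/\ init M' = init M,
      label M' = label M &
      forall s, \sum_t `|trans M s t - trans M' s t| <= eps].

Definition perturbed_bisimulation eps M E : Prop :=
  equivalence_rel E /\
  exists M' : lmc R AP S, perturbation eps M M' /\ bisimulation M' E.

Definition perturbed_bisimilar eps M (s t : S) : Prop :=
  exists E : rel S, perturbed_bisimulation eps M E /\ E s t.

Definition rel_image E (A : {set S}) : {set S} :=
  [set t | [exists s in A, E s t]].

Definition eps_bisimulation eps M E : Prop :=
  [/\ reflexive E, symmetric E &
   forall s t, E s t -> forall A : {set S},
     label M s = label M t /\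
     prob (trans M s) A <= prob (trans M t) (rel_image E A) + eps].

Definition transitive_eps_bisimilar eps M (s t : S) : Prop :=
  exists E : rel S, [/\ eps_bisimulation eps M E, transitive E & E s t].

End Relations.

(* Main.v *)
(** If [E] is a bisimulation of a perturbation [P'], then [P s] and [P' s]
    differ by at most eps/2 on every set, so that passing from [P s] to
    [P' s], to [P' t] and to [P t] on an [E]-closed set costs at most eps.

    The converse fails because three distributions at pairwise total variation
    distance eps need not have a common center at distance eps/2: a center of
    (1 - eps) C + eps X_i, for X_1 = C, X_2, X_3 disjoint, would have mass at
    least 1 - eps/2 on C and eps/2 on each of X_2 and X_3.  This is realized by
    [u -> v], [v -> (1 - eps) w + eps x] and [w -> (1 - eps) w + eps y], where
    [u], [v], [w] form the class C, while [x] and [y] carry the other label,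
    [x] loops and [y -> u].  Relating [u] and [v] already forces
    [w] into their class. *)
Require Import Defs.
From mathcomp Require Import all_boot all_order all_algebra.
From mathcomp Require Import boolp classical_sets reals.
From mathcomp Require Import lra.

Set Implicit Arguments.
Unset Strict Implicit.
Unset Printing Implicit Defensive.

Import Order.TTheory GRing.Theory Num.Theory.

Local Open Scope ring_scope.

(** * Probabilities of sets and the l1 distance *)

Section Prob.
Variables (R : realType) (S : finType).
Implicit Types (mu nu : distr R S) (A B : {set S}).

Lemma prob_subset mu A B : A \subset B -> prob mu A <= prob mu B.
Proof.
move=> /finset.setIidPr sAB; rewrite /prob [leRHS](big_setID A) /= sAB.
by rewrite lerDl sumr_ge0 // => t _; apply: distr_ge0.
Qed.

Lemma prob_setT mu : prob mu [set: S] = 1.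
Proof.
by rewrite -(distr_sum1 mu); apply: eq_bigl => t; rewrite inE.
Qed.

Lemma probU mu A B : [disjoint A & B] ->
  prob mu (A :|: B) = prob mu A + prob mu B.
Proof.
move=> dAB; rewrite /prob -bigU //.
by apply: eq_bigl => t; rewrite !inE.
Qed.

Lemma prob_le1 mu A : prob mu A <= 1.
Proof. by rewrite -(prob_setT mu) prob_subset ?finset.subsetT. Qed.

(** Both total masses are 1, so the excess of [mu] over [nu] on [A] equals the excess of [nu] over
    [mu] on [~: A]; the l1 distance bounds the sum of the two. *)
Lemma prob_sub_le_half_l1 mu nu A eps :
  \sum_t `|mu t - nu t| <= eps -> prob mu A <= prob nu A + eps / 2.
Proof.
move=> le_eps.
have splitA (F : S -> R) : \sum_t F t = \sum_(t in A) F t + \sum_(t in ~: A) F t.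
  rewrite (bigID (mem A)) /=; congr (_ + _).
  by apply: eq_bigl => t; rewrite inE.
have h1 : prob mu A - prob nu A <= \sum_(t in A) `|mu t - nu t|.
  by rewrite /prob -sumrB; apply: ler_sum => t _; apply: ler_norm.
have h2 : prob nu (~: A) - prob mu (~: A) <= \sum_(t in ~: A) `|mu t - nu t|.
  by rewrite /prob -sumrB; apply: ler_sum => t _; rewrite distrC ler_norm.
have m1 := distr_sum1 mu; have n1 := distr_sum1 nu.
rewrite !splitA -/(prob _ _) in m1 n1 le_eps.
rewrite -!/(prob _ _) in m1 n1.
lra.
Qed.

End Prob.

(** * Perturbed bisimilarity implies transitive bisimilarity *)

Section Bisimulation.
Variables (R : realType) (AP : countType) (S : finType).
Implicit Types (M : lmc R AP S) (E : rel S) (A : {set S}).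

Lemma subset_rel_image E A : reflexive E -> A \subset rel_image E A.
Proof.
by move=> rE; apply/fintype.subsetP => t At; rewrite inE; apply/exists_inP; exists t.
Qed.

Lemma rel_image_closed E A s t : equivalence_rel E ->
  E s t -> s \in rel_image E A -> t \in rel_image E A.
Proof.
move=> eqE Est; rewrite !inE => /exists_inP[a Aa Eas].
apply/exists_inP; exists a => //.
by rewrite ((eqE a s t).2 Eas).
Qed.

Lemma bisimulation_prob_class M E s t x : bisimulation M E -> E s t ->
  prob (trans M s) [set y | E x y] = prob (trans M t) [set y | E x y].
Proof.
move=> [_ bE] /bE[_]; apply; apply/imsetP; exists x; rewrite ?inE //.
by apply/finset.setP => y; rewrite !inE.
Qed.

(** [rel_image E A] is a disjoint union of [E]-classes, and the probabilities agree on each. *)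
Lemma bisimulation_prob_rel_image M E s t A : bisimulation M E -> E s t ->
  prob (trans M s) (rel_image E A) = prob (trans M t) (rel_image E A).
Proof.
move=> bE Est; have eqE := bE.1; set B := rel_image E A.
have pB : finset.partition (equivalence_partition E B) B.
  by apply: equivalence_partitionP => x y z _ _ _; apply: eqE.
rewrite /prob !(set_partition_big _ pB) /=; apply: eq_bigr => C.
case/imsetP => x Bx ->; rewrite -!/(prob _ _).
have -> : [set y in B | E x y] = [set y | E x y].
  apply/finset.setP => y; rewrite !inE; apply/andb_idl => Exy.
  by have := rel_image_closed eqE Exy Bx; rewrite inE.
exact: bisimulation_prob_class.
Qed.

Lemma perturbed_bisimilar_transitive eps M s t :
  perturbed_bisimilar eps M s t -> transitive_eps_bisimilar eps M s t.
Proof.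
move=> [E [[eqE [M' [[_ lM' dM'] bE]]] Est]]; exists E.
have rE : reflexive E by move=> x; case: (eqE x x x).
have sE : symmetric E.
  by move=> x y; apply/idP/idP => /[dup] /(eqE _ _ _).2 <-.
split=> //; last by move=> y x z /(eqE _ _ _).2 ->.
split=> // {}s {}t {}Est A; split.
  by have [+ _] := bE.2 _ _ Est; rewrite lM'.
(* [A] may cut through classes, so it is enlarged to a closed set before passing to [M']. *)
apply: le_trans (prob_subset _ (subset_rel_image A rE)) _.
have h1 := prob_sub_le_half_l1 (rel_image E A) (dM' s).
have h2 : prob (trans M' t) (rel_image E A)
    <= prob (trans M t) (rel_image E A) + eps / 2.
  apply: prob_sub_le_half_l1; apply: le_trans (dM' t).
  by apply: ler_sum => x _; rewrite distrC.
rewrite (bisimulation_prob_rel_image A bE Est) in h1.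
lra.
Qed.

End Bisimulation.

(** * Distributions on at most two points *)

Section TwoPointDistr.
Variables (R : realType) (S : finType) (eps : R) (a b : S).

(** For [a = b] this is the point mass at [a], which covers deterministic moves. *)
Let w (t : S) : R := (1 - eps) * (t == a)%:R + eps * (t == b)%:R.

Let sum_w (A : {set S}) :
  \sum_(t in A) w t = (1 - eps) * (a \in A)%:R + eps * (b \in A)%:R.
Proof.
have sum_eq c : \sum_(t in A) (t == c)%:R = (c \in A)%:R :> R.
  case: (boolP (c \in A)) => Ac.
    rewrite (bigD1 c) //= eqxx big1 ?addr0 // => t /andP[_].
    by move=> /negPf ->.
  by apply: big1 => t At; case: eqP => // tc; rewrite -tc At in Ac.
by rewrite big_split /= -!mulr_sumr !sum_eq.
Qed.

Let w_sum1 : \sum_t w t = 1.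
Proof.
have := sum_w [set: S]; rewrite !inE !mulr1 subrK => <-.
by apply: eq_bigl => t; rewrite inE.
Qed.

Hypothesis eps01 : 0 <= eps <= 1.

Let w_ge0 t : 0 <= w t.
Proof. by have /andP[? ?] := eps01; rewrite addr_ge0 // mulr_ge0 ?subr_ge0. Qed.

Definition two_point : distr R S := Distr w_ge0 w_sum1.

Lemma prob_two_point A :
  prob two_point A = (1 - eps) * (a \in A)%:R + eps * (b \in A)%:R.
Proof. exact: sum_w. Qed.

End TwoPointDistr.

(** * The separating chain *)

Section Counterexample.
Variables (R : realType) (AP : countType) (eps : R).
Hypothesis heps : 0 <= eps <= 1.

Let S : finType := (option bool + bool)%type.
Let u : S := inl None.
Let v : S := inl (Some false).
Let w : S := inl (Some true).
Let x : S := inr false.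
Let y : S := inr true.

Let main_succ (s : S) : S :=
  match s with
  | inl None => v | inl (Some _) => w | inr false => x | inr true => u
  end.

Let side_succ (s : S) : S :=
  match s with
  | inl None => v | inl (Some b) => inr b | inr false => x | inr true => u
  end.

Definition triangle_chain : lmc R AP S :=
  LMC (fun s => two_point (main_succ s) (side_succ s) heps) u
    (fun s => if s is inr _ then [set: AP]%classic else set0%classic).

(** The fibres are {[u], [v], [w]}, {[x]} and {[y]}; the labels do not separate [x] from [y]. *)
Let K (s : S) : option bool := if s is inr b then Some b else None.

Lemma triangle_chain_transitive_bisimilar :
  transitive_eps_bisimilar eps triangle_chain u v.
Proof.
exists (fun s t => K s == K t); split=> //; last first.
  by move=> t s r /eqP -> /eqP ->.
split=> [s | s t | s t Kst A]; [exact: eqxx | exact: eq_sym | split].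
  by case: s t Kst => [?|?] [?|?].
rewrite /= !prob_two_point.
have /andP[e0 e1] := heps.
(* If the main successor of [s] lies in [A], its weight [1 - eps] is matched from [t]; otherwise [A]
   has probability at most [eps] from [s]. *)
have hm : main_succ s \in A ->
    main_succ t \in rel_image (fun s t => K s == K t) A.
  move=> As; rewrite inE; apply/exists_inP; exists (main_succ s) => //.
  by case: s t Kst {As} => [[[]|]|[]] [[[]|]|[]].
case: (main_succ s \in A) hm => [/(_ isT) ->|_];
  case: (side_succ s \in A); case: (side_succ t \in _);
  rewrite ?mulr0 ?mulr1; try case: (_ \in _); rewrite ?mulr0 ?mulr1; lra.
Qed.

Lemma triangle_chain_not_perturbed_bisimilar :
  inhabited AP -> 0 < eps < 1 -> ~ perturbed_bisimilar eps triangle_chain u v.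
Proof.
move=> [a] /andP[e0 e1] [E [[eqE [M' [[_ lM' dM'] bE]]] Euv]].
have rE s : E s s by case: (eqE s s s).
have lab s t : E s t -> label triangle_chain s = label triangle_chain t.
  by move=> /bE.2[]; rewrite lM'.
(* The atom [a] tells the empty label from the full one. *)
have Elr p q : E (inl p) (inr q) = false.
  apply/negP => /lab /= h.
  by have : (set0 : set AP)%classic a by rewrite h.
have Erl p q : E (inr q) (inl p) = false.
  apply/negP => /lab /= h.
  by have : (set0 : set AP)%classic a by rewrite -h.
pose cl s := [set t | E s t].
have lo s r : (1 - eps) * (E r (main_succ s))%:R + eps * (E r (side_succ s))%:R
    <= prob (trans M' s) (cl r) + eps / 2.
  have := prob_sub_le_half_l1 (cl r) (dM' s).
  by rewrite /= prob_two_point !inE.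
have up s r : prob (trans M' s) (cl r) <=
    (1 - eps) * (E r (main_succ s))%:R + eps * (E r (side_succ s))%:R + eps / 2.
  have : prob (trans M' s) (cl r) <= prob (trans triangle_chain s) (cl r) + eps / 2.
    apply: prob_sub_le_half_l1; apply: le_trans (dM' s).
    by apply: ler_sum => t _; rewrite distrC.
  by rewrite /= prob_two_point !inE.
have same := bisimulation_prob_class _ bE.
(* [x] surely stays in its class and [y] surely avoids it: a gap of 1, while perturbing both rows
   closes at most [eps < 1]. *)
have nExy : E x y = false.
  apply/negP => Exy.
  have := lo x x; have := up y x.
  rewrite /= rE Erl (same _ _ x Exy) -/(cl x) ?(mulr0, mulr1).
  lra.
(* The same gap: [u] surely enters the class of [v], which [v] would surely leave if [w] were
   outside it. *)
have Evw : E v w.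
  apply/negPn/negP => /negPf nEvw.
  have := lo u v; have := up v v.
  rewrite /= rE Elr nEvw (same _ _ v Euv) -/(cl v) ?(mulr0, mulr1).
  lra.
have Euw : E u w by rewrite ((eqE u v w).2 Euv).
(* In [M'] the states [u], [v], [w] agree on classes, so all three bounds become bounds on
   [trans M' u]: at least [1 - eps / 2] on [cl v] and [eps / 2] on each of [cl x] and [cl y]. By
   disjointness the total is at least [1 + eps / 2]. *)
have hv := lo u v; have hx := lo v x; have hy := lo w y.
rewrite /= rE !mulr1 in hv.
rewrite /= rE Erl mulr0 mulr1 -(same _ _ x Euv) -/(cl x) in hx.
rewrite /= rE Erl mulr0 mulr1 -(same _ _ y Euw) -/(cl y) in hy.
have disj s t : E s t = false -> [disjoint cl s & cl t].
  move=> nEst; apply/pred0P => z /=; rewrite !inE; apply/negP => /andP[Esz Etz].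
  by rewrite ((eqE s z t).2 Esz) -((eqE t z t).2 Etz) rE in nEst.
have dxyv : [disjoint cl x :|: cl y & cl v].
  by rewrite -setI_eq0 finset.setIUl !disjoint_setI0 ?finset.setU0 ?disj ?Erl.
have := prob_le1 (trans M' u) (cl x :|: cl y :|: cl v).
rewrite !probU ?disj //; lra.
Qed.

End Counterexample.

Theorem lemma4p6 (R : realType) (AP : countType) (eps : R)
    (heps : 0 <= eps <= 1) :
  (forall (S : finType) (M : lmc R AP S) (s t : S),
     perturbed_bisimilar eps M s t -> transitive_eps_bisimilar eps M s t) /\
  (inhabited AP -> 0 < eps < 1 ->
   exists (S : finType) (M : lmc R AP S) (s t : S),
     transitive_eps_bisimilar eps M s t /\ ~ perturbed_bisimilar eps M s t).
Proof.
split=> [S M s t|hAP heps01]; first exact: perturbed_bisimilar_transitive.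
exists _, (triangle_chain AP heps), (inl None), (inl (Some false)); split.
  exact: triangle_chain_transitive_bisimilar.
exact: triangle_chain_not_perturbed_bisimilar.
Qed.
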